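(* Let $A_{\ell,m,n}$ ($\ell,m,n\ge0$) be the rational numbers defined by the expansion $$ \tau(z)=\sum_{\ell,m,n\ge0}A_{\ell,m,n}\left(\tfrac12 g_2\right)^\ell(6\lambda)^m(2g_3)^n\frac{z^{4\ell+5m+6n+1}}{(4\ell+5m+6n+1)!} $$ of the normalized tau-function of the first Painlevé equation $u''=6u^2-6\lambda z-\tfrac12g_2$ associated with the solution $u(z;g_2,\lambda,g_3)$. Subject to fixing $A_{0,0,0}=1$, $A_{0,0,1}=-3$, the coefficients $A_{\ell,m,n}$ are completely determined by the recursion $$ \frac{s(s-1)(s-2)(s-7)}{s!}A_{\ell,m,n}=-\frac12\sum_{\substack{\ell_1+\ell_2=\ell \\ {m_1+m_2=m} \\ {n_1+n_2=n}}}{}^{'}\ \frac{b_{s_1,s_2}}{s_1!\,s_2!}A_{\ell_1,m_1,n_1}A_{\ell_2,m_2,n_2} +\sum_{\substack{\ell_1+\ell_2=\ell \\ {m_1+m_2=m-1} \\ {n_1+n_2=n}}}\frac{A_{\ell_1,m_1,n_1}A_{\ell_2,m_2,n_2}}{s_1!\,s_2!} +\sum_{\substack{\ell_1+\ell_2=\ell-1 \\ {m_1+m_2=m} \\ {n_1+n_2=n}}}\frac{A_{\ell_1,m_1,n_1}A_{\ell_2,m_2,n_2}}{s_1!\,s_2!}, $$ where $s=4\ell+5m+6n+1$, $s_j=4\ell_j+5m_j+6n_j+1$ for $j=1,2$, and $\sum'$ denotes that the terms with $(\ell_1,m_1,n_1)=(0,0,0)$ or $(\ell_1,m_1,n_1)=(\ell,m,n)$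 are omitted from the sum.
   Context: For complex $g_2,\lambda,g_3$, $u(z)=u(z;g_2,\lambda,g_3)$ denotes the meromorphic solution on $\mathbb{C}$ of $\frac{d^2u}{dz^2}=6u^2-6\lambda z-\frac{g_2}{2}$ with a double pole at $z=0$ whose Laurent expansion there is $u(z)=\sum_{n\ge0}c_nz^{n-2}$ with $c_0=1$ and $c_6=g_3/28$ (all other coefficients are then determined by the differential equation; $c_6$ is the only free coefficient). A tau-function of $u$ is a holomorphic function $\tau$ with $u=-\frac{d^2}{dz^2}\log\tau$; it is defined up to $\tau\to e^{az+b}\tau$, and it has a simple zero at $z=0$. The normalized tau-function is the unique one with $\tau(0)=0$, $\tau'(0)=1$, $\tau''(0)=0$. The Taylor coefficient of $z^{n+1}$ in $\tau$ is a polynomial in $g_2,\lambda,g_3$ with rational coefficients, weighted homogeneous of degree $n$ with weights $4,5,6$ for $g_2,\lambda,g_3$; hence $\tau$ can be written as the triple sum in the claim, with uniquely defined rational numbers $A_{\ell,m,n}$ independent of $g_2,\lambda,g_3$. The integers $b_{j,k}$ are $b_{j,k}=4!\sum_{r=0}^{4}(-1)^r\binom{j}{r}\binom{k}{4-r}$. All summation indices $\ell_i,m_i,n_i$ are non-negative integers, and empty sums are zero. *)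

(* Defs.v *)
From HB Require Import structures.
From mathcomp Require Import all_boot all_order all_algebra.
From mathcomp Require Import all_classical all_reals all_analysis.
From mathcomp Require Import complex.

Set Implicit Arguments.
Unset Strict Implicit.
Unset Printing Implicit Defensive.

Import Order.TTheory GRing.Theory Num.Theory.
Import numFieldNormedType.Exports.

Local Open Scope ring_scope.
Local Open Scope classical_set_scope.

(* The complex numbers, typed as a numFieldType so that the topology, norm and
   (complex) derivative of MathComp-Analysis over a numFieldType apply:
   [derivable f z 1] is complex differentiability and [derive1 f] is df/dz. *)
Definition Cplx (R : realType) : numFieldType := R[i].

Definition holomorphic_at (R : realType) (f : Cplx R -> Cplx R) (p : Cplx R) :=
  \forall z \near p, derivable f z 1.

(* A meromorphic function is a total function whose values at its poles are
   irrelevant. *)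
Definition meromorphic (R : realType) (f : Cplx R -> Cplx R) :=
  forall p : Cplx R, exists (k : nat) (h : Cplx R -> Cplx R),
    holomorphic_at h p /\ \forall z \near p^', f z = h z / (z - p) ^+ k.

Definition painleve1_equation (R : realType) (g2 lambda : Cplx R)
    (u : Cplx R -> Cplx R) :=
  forall z : Cplx R, holomorphic_at u z ->
    derivable (derive1 u) z 1 /\
    derive1n 2 u z = 6 * u z ^+ 2 - 6 * lambda * z - g2 / 2.

Definition laurent_at0 (R : realType) (c : nat -> Cplx R)
    (u : Cplx R -> Cplx R) :=
  \forall z \near (0 : Cplx R)^',
    series (fun n : nat => c n * z ^ (n%:Z - 2)) @ \oo --> u z.

(* u is the function u( . ; g2, lambda, g3) *)
Definition painleve1_solution (R : realType) (g2 lambda g3 : Cplx R)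
    (u : Cplx R -> Cplx R) :=
  [/\ meromorphic u,
      painleve1_equation g2 lambda u &
      exists c : nat -> Cplx R,
        [/\ c 0%N = 1, c 6%N = g3 / 28 & laurent_at0 c u]].

(* The derivative of log tau is the logarithmic derivative tau' / tau, which
   does not depend on the branch of the logarithm. *)
Definition log_derivative (R : realType) (tau : Cplx R -> Cplx R) :=
  fun z : Cplx R => derive1 tau z / tau z.

Definition tau_function (R : realType) (u tau : Cplx R -> Cplx R) :=
  [/\ forall z : Cplx R, derivable tau z 1,
      exists z : Cplx R, tau z != 0 &
      forall z : Cplx R, tau z != 0 -> u z = - derive1 (log_derivative tau) z].

Definition normalized_tau (R : realType) (u tau : Cplx R -> Cplx R) :=
  tau_function u tau /\ [/\ tau 0 = 0, derive1 tau 0 = 1 & derive1n 2 tau 0 = 0].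

Definition triple : Type := (nat * nat * nat)%type.

Definition sdeg (i : triple) : nat :=
  let: (l, m, n) := i in (4 * l + 5 * m + 6 * n + 1)%N.

Definition tau_term (R : realType) (A : triple -> rat)
    (g2 lambda g3 z : Cplx R) (i : triple) : Cplx R :=
  let: (l, m, n) := i in
  ratr (A i) * (2^-1 * g2) ^+ l * (6 * lambda) ^+ m * (2 * g3) ^+ n *
  (z ^+ sdeg i / (sdeg i)`!%:R).

(* The triple series is the Taylor series of tau in z: for every N the finitely
   many terms in z ^+ N (for which l, m, n <= N) are collected. *)
Definition tau_expansion (R : realType) (A : triple -> rat)
    (g2 lambda g3 : Cplx R) (tau : Cplx R -> Cplx R) :=
  forall z : Cplx R,
    series (fun N : nat =>
      \sum_(l < N.+1) \sum_(m < N.+1)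
        \sum_(n < N.+1 | sdeg (l : nat, m : nat, n : nat) == N)
          tau_term A g2 lambda g3 z (l : nat, m : nat, n : nat)) @ \oo --> tau z.

Definition bcoef (j k : nat) : int :=
  4`!%:Z * \sum_(r < 5) (-1) ^+ r * 'C(j, r)%:Z * 'C(k, 4 - r)%:Z.

(* Sum of F (l1, m1, n1) (l2, m2, n2) over all l1 + l2 = l, m1 + m2 = m,
   n1 + n2 = n. *)
Definition sum_splits (F : triple -> triple -> rat) (l m n : nat) : rat :=
  \sum_(l1 < l.+1) \sum_(m1 < m.+1) \sum_(n1 < n.+1)
    F (l1 : nat, m1 : nat, n1 : nat) (l - l1, m - m1, n - n1)%N.

Definition tau_recursion (A : triple -> rat) (l m n : nat) : Prop :=
  let s := sdeg (l, m, n) in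
  let prod_term i1 i2 := A i1 * A i2 / ((sdeg i1)`!%:R * (sdeg i2)`!%:R) in
  s%:R * (s%:R - 1) * (s%:R - 2) * (s%:R - 7) / s`!%:R * A (l, m, n) =
  - 2^-1 * sum_splits (fun i1 i2 =>
             if (i1 == (0, 0, 0)%N) || (i1 == (l, m, n)) then 0
             else (bcoef (sdeg i1) (sdeg i2))%:~R * prod_term i1 i2) l m n
  + (if m is m'.+1 then sum_splits prod_term l m' n else 0)
  + (if l is l'.+1 then sum_splits prod_term l' m n else 0).

(* Main.v *)
(* Writing u = - (log tau)'', the Painleve equation becomes Hirota's bilinear
   equation
     tau tau'''' - 4 tau' tau''' + 3 tau''^2 = (6 lambda z + g2/2) tau^2,
   whose left-hand side has the Taylor coefficients
   (1/2) sum_(j+k=N) b_(j,k) t_j t_k in degree N - 4, where the t_j are those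
   of tau.  Since each t_j is a polynomial in x = g2/2, y = 6 lambda, w = 2 g3
   and the identity holds for all values of the parameters, it splits into one
   identity for each monomial x^l y^m w^n; isolating the two extreme terms,
   where b_(1,s) = s(s-1)(s-2)(s-7), gives the recursion.  The resonance s = 7
   is resolved by comparing the coefficient c_6 = g3/28 of u with tau.
   A Taylor series is handled through its truncations: near 0, f equals a
   polynomial up to O(z^(N+1)), a relation stable under sums and products. *)

Require Import Defs.
From HB Require Import structures.
From mathcomp Require Import all_boot all_order all_algebra.
From mathcomp Require Import all_classical all_reals all_analysis.
From mathcomp Require Import complex.
From mathcomp Require Import ring zify.

Set Implicit Arguments.
Unset Strict Implicit.
Unset Printing Implicit Defensive.

Import Order.TTheory GRing.Theory Num.Theory.
Import numFieldNormedType.Exports.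

Local Open Scope ring_scope.
Local Open Scope classical_set_scope.

(** * Bounds and convergence of series *)

Lemma lim_norm_le (F : numFieldType) (u : nat -> F) (l M : F) :
  u @ \oo --> l -> (forall n, `|u n| <= M) -> `|l| <= M.
Proof.
move=> ul uM; apply/ler_addgt0Pr => e e0.
have [n _ /(_ n (leqnn n)) /= le] := (@cvgrPdist_le _ _ _ _ _ _ _).1 ul e e0.
rewrite -(subrK (u n) l) addrC; apply: le_trans (ler_normD _ _) _.
exact: lerD.
Qed.

Lemma sum_half_le (F : numFieldType) n : \sum_(0 <= i < n) 2^-1 ^+ i <= 2 :> F.
Proof.
suff -> : \sum_(0 <= i < n) 2^-1 ^+ i = 2 - 2 * 2^-1 ^+ n :> F.
  by rewrite gerBl mulr_ge0// exprn_ge0// invr_ge0.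
elim: n => [|n IH]; first by rewrite big_nil expr0 mulr1 subrr.
by rewrite big_nat_recr//= IH exprS; field.
Qed.

Lemma series_norm_le (F : numFieldType) (u : nat -> F) M n :
  (forall i, `|u i| <= M * 2^-1 ^+ i) -> `|series u n| <= M * 2.
Proof.
move=> uM; apply: le_trans (ler_norm_sum _ _ _) _.
apply: le_trans (ler_sum _ (fun i _ => uM i)) _; rewrite -mulr_sumr.
apply: ler_wpM2l (sum_half_le _ _).
by apply: le_trans (normr_ge0 (u 0%N)) _; have := uM 0%N; rewrite expr0 mulr1.
Qed.

Lemma cvg_series_bounded (F : numFieldType) (u : nat -> F) :
  cvgn (series u) -> exists M, forall n, `|u n| <= M.
Proof.
move=> /cvg_series_cvg_0 /cvgrPdist_le /(_ 1 ltr01) [N _ uN].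
exists (1 + \sum_(i < N) `|u i|) => n.
have [Nn|nN] := leqP N n.
  have := uN n Nn; rewrite /= sub0r normrN => /le_trans; apply.
  by rewrite lerDl sumr_ge0.
rewrite (bigD1 (Ordinal nN))//= addrCA lerDl addr_ge0//.
by rewrite sumr_ge0.
Qed.

Lemma cvgn_near_le (F : numFieldType) (u : nat -> F) (l : F) :
  (forall e : F, 0 < e -> \forall n \near \oo, `|l - u n| <= e) ->
  u @ \oo --> l.
Proof. by move=> ul; apply/cvgrPdist_le. Qed.

(** Completeness is used in [R] only: the real and imaginary parts are dominated by a geometric
    series, hence converge absolutely, and the two limits are reassembled. *)
Lemma complex_series_cvg (R : realType) (u : nat -> Cplx R) (M : Cplx R) :
  (forall n, `|u n| <= M * 2^-1 ^+ n) ->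
  exists l : Cplx R, series u @ \oo --> l.
Proof.
move=> uM.
have M0 : 0 <= M.
  by apply: le_trans (normr_ge0 (u 0%N)) _; have := uM 0%N; rewrite expr0 mulr1.
(* A nonnegative element for the order on the complex numbers is real, so the comparison can take
   place in [R]; [e] is treated likewise below. *)
have ME : M = (complex.Re M)%:C%C by rewrite RRe_real// ger0_real.
set m := complex.Re M in ME.
have bnd (p : Cplx R -> R) : (forall z : Cplx R, (`|p z|%:C)%C <= `|z|) ->
    cvgn (series (p \o u)).
  move=> pz; apply: normed_cvg.
  apply: (@series_le_cvg _ _ (geometric m 2^-1)) => [n|n|n|].
  - exact: normr_ge0.
  - rewrite /= mulr_ge0 ?exprn_ge0 ?invr_ge0//.
    by have := M0; rewrite ME; rewrite ler0c.
  - rewrite -lecR; apply: le_trans (pz _) _; apply: le_trans (uM n) _.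
    by rewrite ME /= rmorphM rmorphXn fmorphV rmorph_nat.
  - apply: is_cvg_geometric_series.
    by rewrite ger0_norm ?invr_ge0// invf_lt1// ltr1n.
have Rez (z : Cplx R) : (`|complex.Re z|%:C)%C <= `|z|.
  rewrite normc_def lecR -sqrtr_sqr ler_wsqrtr// lerDl sqr_ge0//.
have Imz (z : Cplx R) : (`|complex.Im z|%:C)%C <= `|z|.
  rewrite normc_def lecR -sqrtr_sqr ler_wsqrtr// lerDr sqr_ge0//.
have /cvg_ex[/= a ua] := bnd _ Rez.
have /cvg_ex[/= b ub] := bnd _ Imz.
exists (a +i* b)%C; apply: (@cvgn_near_le (Cplx R)) => e e0.
have eE : e = ((complex.Re e)%:C)%C by rewrite RRe_real// ger0_real// ltW.
have e2 : 0 < complex.Re e / 2.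
  by rewrite divr_gt0//; have := e0; rewrite eE ltcR.
move/cvgrPdist_le : ua => /(_ _ e2) ua; move/cvgrPdist_le : ub => /(_ _ e2) ub.
have Se n : series u n = (series (complex.Re (R:=R) \o u) n
                        +i* series (complex.Im (R:=R) \o u) n)%C.
  elim: n => [|n IH]; first by rewrite /series /= !big_nil.
  rewrite !seriesSr IH /=; case: (u n) => x y //=.
have nr (r : R) : `|(r%:C)%C : Cplx R| = (`|r|%:C)%C.
  by rewrite normc_def /= expr0n addr0 sqrtr_sqr.
have dist (x y : R) : `|a - x| <= complex.Re e / 2 ->
    `|b - y| <= complex.Re e / 2 -> `|(a +i* b)%C - (x +i* y)%C : Cplx R| <= e.
  move=> ax by_.
  have -> : ((a +i* b)%C - (x +i* y)%C : Cplx R)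
      = ((a - x)%:C + 'i * (b - y)%:C)%C.
    by apply/eqP; rewrite eq_complex /=; apply/andP; split; apply/eqP; ring.
  apply: le_trans (ler_normD _ _) _; rewrite normrM.
  have -> : `|('i)%C : Cplx R| = 1.
    by rewrite normc_def /= expr0n add0r expr1n sqrtr1.
  by rewrite mul1r !nr -rmorphD [leRHS]eE lecR [leRHS]splitr lerD.
near=> n; rewrite Se; apply: dist; near: n.
- exact: ua.
- exact: ub.
Unshelve. all: by end_near. Qed.

(** * Entire power series and termwise differentiation *)

Definition power_sum (F : numFieldType) (a : nat -> F) (f : F -> F) :=
  forall z : F, series (fun n => a n * z ^+ n) @ \oo --> f z.

Definition deriv_coef (F : numFieldType) (a : nat -> F) : nat -> F :=
  fun n => a n.+1 *+ n.+1.

(** The series converges everywhere, so the radius [r] is arbitrary; later proofs choose it large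
    enough to leave a geometric factor to spare. *)
Lemma power_sum_bounded (F : numFieldType) (a : nat -> F) f (r : F) :
  power_sum a f -> 0 <= r -> exists M, forall n, `|a n| * r ^+ n <= M.
Proof.
move=> af r0; have [M aM] := cvg_series_bounded (cvgP _ (af r)).
by exists M => n; have := aM n; rewrite normrM normrX (ger0_norm r0).
Qed.

Lemma power_sum_deriv (R : realType) (a : nat -> Cplx R) f :
  power_sum a f -> exists g, power_sum (deriv_coef a) g.
Proof.
move=> af; suff ex z : exists l : Cplx R,
    series (fun n => deriv_coef a n * z ^+ n) @ \oo --> l.
  by have [g ag] := choice ex; exists g.
have z1 : 0 <= `|z| + 1 by rewrite addr_ge0.
(* The radius exceeds [|z|] by a factor of at least 4: one factor [2 ^+ n.+1] absorbs the multiplier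
   [n.+1] of the derivative, the other leaves the ratio 1/2. *)
have [M aM] := power_sum_bounded af (mulr_ge0 (ler0n (Cplx R) 4) z1).
have M0 : 0 <= M by apply: le_trans (aM 0%N); rewrite mulr1.
apply: (@complex_series_cvg _ _ M) => n.
rewrite /deriv_coef normrM normrX normrMn.
have le1 : `|a n.+1| *+ n.+1 * `|z| ^+ n
    <= `|a n.+1| * 2 ^+ n.+1 * (`|z| + 1) ^+ n.+1.
  apply: ler_pM => //.
    rewrite -[leLHS]mulr_natr; apply: ler_wpM2l => //.
    by rewrite -natrX ler_nat ltnW// ltn_expl.
  rewrite exprS; apply: le_trans (_ : (`|z| + 1) ^+ n <= _).
    by apply: lerXn2r; rewrite ?nnegrE// lerDl.
  by rewrite ler_peMl ?exprn_ge0// lerDr.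
apply: le_trans le1 _.
have -> : `|a n.+1| * 2 ^+ n.+1 * (`|z| + 1) ^+ n.+1
    = `|a n.+1| * (4 * (`|z| + 1)) ^+ n.+1 * 2^-1 ^+ n.+1.
  rewrite exprMn (_ : 4 = 2 * 2) ?exprMn; last by rewrite -natrM.
  rewrite exprVn; field; by rewrite expf_neq0.
apply: ler_pM => //.
- by rewrite exprS ler_piMl ?exprn_ge0 ?invr_ge0// invf_le1// ler1n.
Qed.

(** The remainder of the first-order expansion of a power is quadratic in [h] with a constant only
    geometric in [n], so it can be summed against the coefficients of an entire series. *)
Lemma expr_taylor1_le (F : numFieldType) (z h : F) n : `|h| <= 1 ->
  `|(z + h) ^+ n - z ^+ n - z ^+ n.-1 *+ n * h|
    <= `|h| ^+ 2 * (2 * (`|z| + 1)) ^+ n.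
Proof.
move=> h1; set r := `|z| + 1.
have r1 : 1 <= r by rewrite lerDr.
have r0 : 0 <= r by exact: le_trans ler01 r1.
elim: n => [|n IH].
  by rewrite subrr mulr0n mul0r subrr normr0 expr0 mulr1 exprn_ge0.
(* Writing E(n) for the remainder, E(n+1) = (z + h) E(n) + n z^(n-1) h^2; each summand takes half of
   the bound for [n.+1]. *)
have -> : (z + h) ^+ n.+1 - z ^+ n.+1 - z ^+ n *+ n.+1 * h =
    (z + h) * ((z + h) ^+ n - z ^+ n - z ^+ n.-1 *+ n * h)
    + z ^+ n.-1 *+ n * h ^+ 2.
  case: n {IH} => [|n] /=; first by rewrite !expr0 expr1 mulr0n; ring.
  rewrite -(mulr_natr (z ^+ n.+1) n.+2) -(mulr_natr (z ^+ n) n.+1).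
  by rewrite !exprS -[n.+2]addn1 natrD; ring.
apply: le_trans (ler_normD _ _) _.
have le1 : `|(z + h) * ((z + h) ^+ n - z ^+ n - z ^+ n.-1 *+ n * h)|
    <= `|h| ^+ 2 * (r * (2 * r) ^+ n).
  rewrite normrM [leRHS]mulrCA; apply: ler_pM => //.
  by apply: le_trans (ler_normD _ _) _; rewrite lerD2l.
have le2 : `|z ^+ n.-1 *+ n * h ^+ 2| <= `|h| ^+ 2 * (r * (2 * r) ^+ n).
  rewrite normrM normrX mulrC; apply: ler_wpM2l; first exact: exprn_ge0.
  rewrite normrMn normrX -[leLHS]mulr_natl exprMn mulrCA; apply: ler_pM => //.
  - by rewrite -natrX ler_nat ltnW// ltn_expl.
  - case: n {IH le1} => [|n] /=; first by rewrite !expr0 mulr1.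
    apply: le_trans (_ : r ^+ n.+1 <= _); last first.
      by rewrite ler_peMl ?exprn_ge0.
    rewrite exprS; apply: le_trans (_ : r ^+ n <= _).
      by apply: lerXn2r; rewrite ?nnegrE// lerDl.
    by rewrite ler_peMl ?exprn_ge0.
apply: le_trans (lerD le1 le2) _.
rewrite -mulrDr; apply: ler_wpM2l; first by rewrite exprn_ge0.
by rewrite (exprS (2 * r)) -[2 * r * _]mulrA [leRHS]mulr_natl mulr2n.
Qed.

(** The term of index 0 vanishes. Keeping the index of [a] lines this series up, term by term, with
    the difference quotients of [f]. *)
Lemma power_sum_shift (F : numFieldType) (a : nat -> F) (g : F -> F) z :
  power_sum (deriv_coef a) g ->
  series (fun n => a n * (z ^+ n.-1 *+ n)) @ \oo --> g z.
Proof.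
move=> ag; rewrite -cvg_shiftS; apply: cvg_trans (ag z).
suff -> : [sequence series (fun k => a k * (z ^+ k.-1 *+ k)) n.+1]_n =
    series (fun n => deriv_coef a n * z ^+ n) by [].
apply/funext => n; rewrite /series /= big_nat_recl//= mulr0n mulr0 add0r.
by apply: eq_bigr => i _; rewrite /deriv_coef mulrnAr mulrnAl.
Qed.

(** Summing [expr_taylor1_le] over all terms makes f(z+h) - f(z) - g(z) h of order h^2, so the
    difference quotient tends to [g z]. *)
Lemma power_sum_is_derive (F : numFieldType) (a : nat -> F) (f g : F -> F) :
  power_sum a f -> power_sum (deriv_coef a) g ->
  forall z : F, is_derive z 1 f (g z).
Proof.
move=> af ag z.
(* Twice the base [2 * (|z| + 1)] of [expr_taylor1_le], which leaves the ratio 1/2. *)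
have r0 : 0 <= 4 * (`|z| + 1) by rewrite mulr_ge0// addr_ge0.
have [M aM] := power_sum_bounded af r0.
have M0 : 0 <= M by apply: le_trans (aM 0%N); rewrite mulr1.
have bnd (h : F) : `|h| <= 1 ->
    `|f (z + h) - f z - g z * h| <= `|h| ^+ 2 * M * 2.
  move=> h1; apply: (@lim_norm_le _ (series (fun n =>
      a n * ((z + h) ^+ n - z ^+ n - z ^+ n.-1 *+ n * h)))); last first.
    move=> n; apply: series_norm_le => i; rewrite normrM.
    apply: le_trans (ler_wpM2l (normr_ge0 _) (expr_taylor1_le z i h1)) _.
    rewrite mulrCA -[leRHS]mulrA; apply: ler_wpM2l; first by rewrite exprn_ge0.
    have -> : 2 * (`|z| + 1) = 4 * (`|z| + 1) * 2^-1 by field.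
    by rewrite exprMn mulrA ler_wpM2r ?exprn_ge0 ?invr_ge0.
  have -> : series (fun n =>
      a n * ((z + h) ^+ n - z ^+ n - z ^+ n.-1 *+ n * h)) =
    (fun n => series (fun n => a n * (z + h) ^+ n) n -
    series (fun n => a n * z ^+ n) n -
    series (fun n => a n * (z ^+ n.-1 *+ n)) n * h).
    apply/funext => n; rewrite /series /= mulr_suml -!sumrB.
    by apply: eq_bigr => i _; rewrite !mulrBr mulrA.
  apply: cvgB; first by apply: cvgB; [exact: af|exact: af].
  by apply: cvgM (power_sum_shift ag) _; exact: cvg_cst.
have lim :
    (fun h => h^-1 *: ((f \o shift z) (h *: (1 : F)) - f z)) @ 0^' --> g z.
  apply/cvgrPdist_le => e e0.
  (* The added 1 keeps the denominator positive when [M] is 0. *)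
  have d0 : 0 < e / (M * 2 + 1) by rewrite divr_gt0// ltr_wpDl// mulr_ge0.
  near=> h.
  have hn0 : h != 0 by near: h; exact: nbhs_dnbhs_neq.
  have h1 : `|h| <= 1 by near: h; exact: dnbhs0_le.
  have hd : `|h| <= e / (M * 2 + 1) by near: h; exact: dnbhs0_le.
  rewrite /= /shift /= [h *: 1]mulr1 [h + z]addrC.
  have -> : g z - h^-1 *: (f (z + h) - f z) =
      - (h^-1 * (f (z + h) - f z - g z * h)).
    by rewrite /GRing.scale /=; field.
  rewrite normrN normrM normfV ler_pdivrMl ?normr_gt0//.
  apply: le_trans (bnd _ h1) _; rewrite expr2 -!mulrA ler_wpM2l//.
  apply: le_trans (_ : `|h| * (M * 2 + 1) <= _).
    by rewrite ler_wpM2l// lerDl.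
  by rewrite -ler_pdivlMr// ltr_wpDl// mulr_ge0.
by apply: DeriveDef; [exact: cvgP lim | exact: cvg_lim lim].
Unshelve. all: by end_near. Qed.

(** * Truncated expansions at the origin *)

(* [f] agrees with [p] up to O(z^(N+1)); only the coefficients of [p] of degree
   at most [N] are constrained. *)
Definition expansion_at0 (F : numFieldType) (N : nat) (f : F -> F)
    (p : {poly F}) : Prop :=
  exists2 M : F, 0 <= M &
    \forall z \near (0 : F)^', `|f z - p.[z]| <= M * `|z| ^+ N.+1.

Lemma horner_bounded (F : numFieldType) (p : {poly F}) :
  exists2 M : F, 0 <= M & forall z, `|z| <= 1 -> `|p.[z]| <= M.
Proof.
exists (\sum_(i < size p) `|p`_i|) => [|z z1]; first exact: sumr_ge0.
rewrite horner_coef; apply: le_trans (ler_norm_sum _ _ _) _.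
by apply: ler_sum => i _; rewrite normrM normrX ler_piMr// exprn_ile1.
Qed.

Lemma expansion_at0_near (F : numFieldType) N (f g : F -> F) p :
  (\forall z \near (0 : F)^', f z = g z) ->
  expansion_at0 N f p -> expansion_at0 N g p.
Proof.
move=> fg [M M0 fp]; exists M => //; near=> z.
rewrite -(_ : f z = g z); last by near: z.
by near: z.
Unshelve. all: by end_near. Qed.

Lemma expansion_at0_poly (F : numFieldType) N (p : {poly F}) :
  expansion_at0 N (fun z => p.[z]) p.
Proof. by exists 0 => //; near=> z; rewrite subrr normr0 mul0r.
Unshelve. all: by end_near. Qed.

Lemma expansion_at0D (F : numFieldType) N (f g : F -> F) p q :
  expansion_at0 N f p -> expansion_at0 N g q ->
  expansion_at0 N (fun z => f z + g z) (p + q).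
Proof.
move=> [M M0 fp] [K K0 gq]; exists (M + K); first exact: addr_ge0.
near=> z; rewrite hornerD opprD addrACA mulrDl.
apply: le_trans (ler_normD _ _) _; apply: lerD; first by near: z.
by near: z.
Unshelve. all: by end_near. Qed.

Lemma expansion_at0M (F : numFieldType) N (f g : F -> F) p q :
  expansion_at0 N f p -> expansion_at0 N g q ->
  expansion_at0 N (fun z => f z * g z) (p * q).
Proof.
move=> [M M0 fp] [K K0 gq].
have [P P0 pP] := horner_bounded p; have [Q Q0 qQ] := horner_bounded q.
exists (M * (K + Q) + P * K).
  by rewrite addr_ge0 ?mulr_ge0 ?addr_ge0.
near=> z.
have z1 : `|z| <= 1 by near: z; exact: dnbhs0_le.
have fz : `|f z - p.[z]| <= M * `|z| ^+ N.+1 by near: z.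
have gz : `|g z - q.[z]| <= K * `|z| ^+ N.+1 by near: z.
have gK : `|g z| <= K + Q.
  rewrite -(subrK q.[z] (g z)); apply: le_trans (ler_normD _ _) _.
  apply: lerD (qQ _ z1); apply: le_trans gz _.
  by rewrite ler_piMr// exprn_ile1.
rewrite hornerM.
have -> : f z * g z - p.[z] * q.[z] =
    (f z - p.[z]) * g z + p.[z] * (g z - q.[z]) by ring.
apply: le_trans (ler_normD _ _) _; rewrite [leRHS]mulrDl !normrM; apply: lerD.
  by rewrite mulrAC; apply: ler_pM.
by rewrite -mulrA; apply: ler_pM => //; exact: pP.
Unshelve. all: by end_near. Qed.

Lemma expansion_at0Z (F : numFieldType) N (f : F -> F) p c :
  expansion_at0 N f p -> expansion_at0 N (fun z => c * f z) (c *: p).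
Proof.
move=> fp; rewrite -mul_polyC.
apply: expansion_at0M fp.
apply: (@expansion_at0_near _ _ (fun z => (c%:P).[z])).
  by near=> z; rewrite hornerC.
exact: expansion_at0_poly.
Unshelve. all: by end_near. Qed.

(** This is how an identity between functions becomes an identity between coefficients. The
    polynomial itself is O(z^(N+1)), so its constant coefficient vanishes; dividing by z and
    inducting on [N] gives the others. *)
Lemma expansion_at0_eq0 (F : numFieldType) N (f : F -> F) (p : {poly F}) :
  expansion_at0 N f p -> (\forall z \near (0 : F)^', f z = 0) ->
  forall n, (n <= N)%N -> p`_n = 0.
Proof.
move=> fp f0; have {f fp f0} [M M0 pM] : expansion_at0 N (fun=> 0) p.
  by apply: expansion_at0_near fp.
have {}pM : \forall z \near (0 : F)^', `|p.[z]| <= M * `|z| ^+ N.+1.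
  near=> z; rewrite -normrN -sub0r; near: z; exact: pM.
have p00 (q : {poly F}) (k : nat) :
    (\forall z \near (0 : F)^', `|q.[z]| <= M * `|z| ^+ k.+1) -> q`_0 = 0.
  move=> qM; apply/eqP; apply: contraT => q0.
  have [K K0 dK] := horner_bounded (drop_poly 1 q).
  (* Below this radius [(K + M) * |z|] is smaller than the modulus of the constant coefficient,
     although it must bound it. *)
  have d0 : 0 < `|q`_0| / (K + M + 1).
    by rewrite divr_gt0 ?normr_gt0// ltr_wpDl// addr_ge0.
  suff : \forall z \near (0 : F)^', False by move=> /filter_ex[].
  near=> z.
  have z1 : `|z| <= 1 by near: z; exact: dnbhs0_le.
  have zd : `|z| < `|q`_0| / (K + M + 1) by near: z; exact: dnbhs0_lt.
  have qz : `|q.[z]| <= M * `|z| ^+ k.+1 by near: z.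
  have qE : q.[z] = q`_0 + (drop_poly 1 q).[z] * z.
    rewrite -{1}[q](poly_take_drop 1) hornerD hornerM expr1 hornerX.
    by congr (_ + _); rewrite horner_poly big_ord1 expr0 mulr1.
  have : `|q`_0| <= (K + M) * `|z|.
    have -> : q`_0 = q.[z] - (drop_poly 1 q).[z] * z by rewrite qE addrK.
    apply: le_trans (ler_normB _ _) _; rewrite addrC mulrDl; apply: lerD.
      by rewrite normrM ler_wpM2r// dK.
    apply: le_trans qz _; apply: ler_wpM2l => //.
    by rewrite exprS ler_piMr// exprn_ile1.
  have lt : (K + M) * `|z| < `|q`_0|.
    apply: le_lt_trans (_ : (K + M + 1) * `|z| < _).
      by rewrite ler_wpM2r// lerDl.
    by rewrite mulrC -ltr_pdivlMr// ltr_wpDl// addr_ge0.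
  by move=> /le_lt_trans /(_ lt); rewrite ltxx.
elim: N p pM => [|N IH] p pM n.
  by rewrite leqn0 => /eqP ->; exact: p00 pM.
have p0 : p`_0 = 0 by exact: p00 pM.
case: n => [//|n]; rewrite ltnS => nN.
have -> : p`_n.+1 = (drop_poly 1 p)`_n by rewrite coef_drop_poly addn1.
apply: IH nN; near=> z.
have zn0 : z != 0 by near: z; exact: nbhs_dnbhs_neq.
have pz : `|p.[z]| <= M * `|z| ^+ N.+2 by near: z.
have pE : p.[z] = (drop_poly 1 p).[z] * z.
  rewrite -{1}[p](poly_take_drop 1) hornerD hornerM expr1 hornerX.
  by rewrite horner_poly big_ord1 p0 mul0r add0r.
rewrite -(ler_pM2r (_ : 0 < `|z|)) ?normr_gt0// -normrM -pE -mulrA -exprSr.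
Unshelve. all: by end_near. Qed.

(** The terms are bounded at one point [z1] of convergence other than 0; for |z| at most |z1| / 2
    the tail from degree N+1 on is then dominated by a geometric series. Only a punctured
    neighbourhood is assumed, so that z^2 u is covered as well. *)
Lemma power_series_expansion (F : numFieldType) (a : nat -> F) (f : F -> F) N :
  (\forall z \near (0 : F)^', series (fun n => a n * z ^+ n) @ \oo --> f z) ->
  expansion_at0 N f (\poly_(i < N.+1) a i).
Proof.
move=> af.
have [z1 [z1f z1n0]] : exists z1,
    series (fun n => a n * z1 ^+ n) @ \oo --> f z1 /\ z1 != 0.
  apply: (@filter_ex _ ((0 : F)^')); near=> z; split.
    by near: z.
  by near: z; exact: nbhs_dnbhs_neq.
have [M aM] := cvg_series_bounded (cvgP _ z1f).
have M0 : 0 <= M by exact: le_trans (aM 0%N).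
have nz1 : 0 < `|z1| by rewrite normr_gt0.
exists (M / `|z1| ^+ N.+1 * 2).
  by rewrite mulr_ge0// divr_ge0// exprn_ge0.
near=> z.
have zle : `|z| <= `|z1| * 2^-1.
  by near: z; apply: dnbhs0_le; rewrite mulr_gt0// invr_gt0.
have fz : series (fun n => a n * z ^+ n) @ \oo --> f z by near: z.
rewrite mulrAC.
apply: (@lim_norm_le _ (series (fun i => a (i + N.+1)%N * z ^+ (i + N.+1)))).
  move: fz; rewrite -(cvg_shiftn N.+1) => fz.
  have -> : series (fun i => a (i + N.+1)%N * z ^+ (i + N.+1)) =
     (fun n => series (fun n => a n * z ^+ n) (n + N.+1)%N -
        (\poly_(i < N.+1) a i).[z]).
    apply/funext => n; rewrite /series /= horner_poly.
    rewrite -(big_mkord xpredT (fun i => a i * z ^+ i)).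
    rewrite (@big_cat_nat _ _ _ N.+1 0 (n + N.+1))//= ?leq_addl//.
    rewrite addrAC subrr add0r.
    rewrite -[RHS]/(\sum_((0 + N.+1)%N <= i < (n + N.+1)%N) a i * z ^+ i).
    by rewrite big_addn addnK.
  by apply: cvgB => //; exact: cvg_cst.
move=> n; apply: series_norm_le => i.
have qle : `|z| / `|z1| <= 2^-1 by rewrite ler_pdivrMr// mulrC.
have -> : a (i + N.+1)%N * z ^+ (i + N.+1) =
    a (i + N.+1)%N * z1 ^+ (i + N.+1) * (z / z1) ^+ (i + N.+1).
  by rewrite -mulrA -exprMn mulrCA divff// mulr1.
rewrite normrM.
have -> : M / `|z1| ^+ N.+1 * `|z| ^+ N.+1 * 2^-1 ^+ i =
    M * (2^-1 ^+ i * (`|z| / `|z1|) ^+ N.+1).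
  by rewrite expr_div_n; ring.
apply: ler_pM => //.
rewrite normrX normrM normfV exprD; apply: ler_pM => //.
- by apply: lerXn2r; rewrite ?nnegrE ?divr_ge0 ?invr_ge0.
Unshelve. all: by end_near. Qed.

(** * Derivation rules and Hirota's bilinear equation *)

Lemma is_derive_mul (F : numFieldType) (f g : F -> F) (z df dg : F) :
  is_derive z 1 f df -> is_derive z 1 g dg ->
  is_derive z 1 (fun w => f w * g w) (df * g z + f z * dg).
Proof.
move=> fd gd; apply: is_derive_eq (is_deriveM fd gd) _.
by rewrite /GRing.scale /=; ring.
Qed.

Lemma is_derive_sub (F : numFieldType) (f g : F -> F) (z df dg : F) :
  is_derive z 1 f df -> is_derive z 1 g dg ->
  is_derive z 1 (fun w => f w - g w) (df - dg).
Proof. exact: is_deriveB. Qed.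

Lemma is_derive_scale (F : numFieldType) (f : F -> F) (z c df : F) :
  is_derive z 1 f df -> is_derive z 1 (fun w => c * f w) (c * df).
Proof. exact: is_deriveZ. Qed.

Lemma is_derive_div (F : numFieldType) (f g : F -> F) (z df dg : F) :
  g z != 0 -> is_derive z 1 f df -> is_derive z 1 g dg ->
  is_derive z 1 (fun w => f w / g w) ((df * g z - f z * dg) / g z ^+ 2).
Proof.
move=> gz fd gd.
have gV : is_derive z 1 (fun w => (g w)^-1) (- (g z) ^- 2 *: dg).
  case: gd => gd <-.
  by apply: DeriveDef; [exact: derivableV | exact: deriveV].
apply: is_derive_eq (is_derive_mul fd gV) _.
by rewrite /GRing.scale /=; field.
Qed.

Lemma is_derive_near_neq0 (F : numFieldType) (f : F -> F) (z df : F) :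
  is_derive z 1 f df -> f z != 0 -> \forall w \near z, f w != 0.
Proof.
move=> [/derivable1_diffP /differentiable_continuous fc _] fz.
exact: cvgr_neq0 fc fz.
Qed.

Lemma is_derive1E (F : numFieldType) (f : F -> F) (z df : F) :
  is_derive z 1 f df -> derive1 f z = df.
Proof. by move=> [_ <-]; rewrite derive1E. Qed.

Section Bilinear.
Variables (F : numFieldType) (t0 t1 t2 t3 t4 u : F -> F).
Hypotheses (d0 : forall z : F, is_derive z 1 t0 (t1 z))
  (d1 : forall z : F, is_derive z 1 t1 (t2 z))
  (d2 : forall z : F, is_derive z 1 t2 (t3 z))
  (d3 : forall z : F, is_derive z 1 t3 (t4 z)).
Hypothesis ut : forall z : F, t0 z != 0 ->
  u z = - derive1 (fun w => derive1 t0 w / t0 w) z.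

Lemma tau_quotientE (z : F) : t0 z != 0 ->
  u z = (t1 z ^+ 2 - t0 z * t2 z) / t0 z ^+ 2.
Proof.
move=> tz; rewrite (ut tz).
have -> : (fun w => derive1 t0 w / t0 w) = (fun w => t1 w / t0 w).
  by apply/funext => w; rewrite (is_derive1E (d0 w)).
rewrite (is_derive1E (is_derive_div tz (d1 z) (d0 z))).
by field.
Qed.

(** Since [t0] is continuous, it stays nonzero near [z]; there [u] coincides with an explicit
    quotient, which can be differentiated in its place. *)
Lemma tau_quotient_derive (z : F) : t0 z != 0 ->
  is_derive z 1 u
    ((3 * t0 z * t1 z * t2 z - t0 z ^+ 2 * t3 z - 2 * t1 z ^+ 3) / t0 z ^+ 3).
Proof.
move=> tz.
apply: (@near_eq_is_derive _ _ _
  (fun w => (t1 w * t1 w - t0 w * t2 w) / (t0 w * t0 w))).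
  near=> w; rewrite tau_quotientE ?expr2//; near: w.
  exact: is_derive_near_neq0 (d0 z) tz.
have num := is_derive_sub (is_derive_mul (d1 z) (d1 z))
  (is_derive_mul (d0 z) (d2 z)).
have den := is_derive_mul (d0 z) (d0 z).
by apply: is_derive_eq (is_derive_div _ num den) _ => /=;
  [rewrite mulf_neq0|field].
Unshelve. all: by end_near. Qed.

Lemma tau_quotient_derive2 (z : F) : t0 z != 0 ->
  is_derive z 1 (derive1 u)
    ((6 * t1 z ^+ 4 - 12 * t0 z * t1 z ^+ 2 * t2 z + 3 * t0 z ^+ 2 * t2 z ^+ 2
     + 4 * t0 z ^+ 2 * t1 z * t3 z - t0 z ^+ 3 * t4 z) / t0 z ^+ 4).
Proof.
move=> tz.
apply: (@near_eq_is_derive _ _ _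
  (fun w => (3 * (t0 w * t1 w * t2 w) - t0 w * t0 w * t3 w
     - 2 * (t1 w * t1 w * t1 w)) / (t0 w * t0 w * t0 w))).
  near=> w; rewrite (is_derive1E (tau_quotient_derive _)).
    by congr (_ / _); ring.
  by near: w; exact: is_derive_near_neq0 (d0 z) tz.
have m (f g h f' g' h' : F -> F) (df : is_derive z 1 f (f' z))
    (dg : is_derive z 1 g (g' z)) (dh : is_derive z 1 h (h' z)) :=
  is_derive_mul (is_derive_mul df dg) dh.
have num := is_derive_sub (is_derive_sub
  (is_derive_scale 3 (m _ _ _ _ _ _ (d0 z) (d1 z) (d2 z)))
  (m _ _ _ _ _ _ (d0 z) (d0 z) (d3 z)))
  (is_derive_scale 2 (m _ _ _ _ _ _ (d1 z) (d1 z) (d1 z))).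
have den := m _ _ _ _ _ _ (d0 z) (d0 z) (d0 z).
by apply: is_derive_eq (is_derive_div _ num den) _ => /=;
  [rewrite !mulf_neq0|field].
Unshelve. all: by end_near. Qed.

End Bilinear.

Lemma tau_bilinear (R : realType) (g2 lambda : Cplx R)
    (u t0 t1 t2 t3 t4 : Cplx R -> Cplx R) (z : Cplx R) :
  (forall z : Cplx R, is_derive z 1 t0 (t1 z)) ->
  (forall z : Cplx R, is_derive z 1 t1 (t2 z)) ->
  (forall z : Cplx R, is_derive z 1 t2 (t3 z)) ->
  (forall z : Cplx R, is_derive z 1 t3 (t4 z)) ->
  (forall z : Cplx R, t0 z != 0 -> u z = - derive1 (log_derivative t0) z) ->
  painleve1_equation g2 lambda u -> t0 z != 0 ->
  t0 z * t4 z - 4 * (t1 z * t3 z) + 3 * t2 z ^+ 2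
    = (6 * lambda * z + g2 / 2) * t0 z ^+ 2.
Proof.
move=> d0 d1 d2 d3 ut pI tz.
(* The differential equation is available only where [u] is holomorphic, which holds wherever tau
   does not vanish. *)
have uh : holomorphic_at u z.
  near=> w; have tw : t0 w != 0.
    by near: w; exact: is_derive_near_neq0 (d0 z) tz.
  by have [] := tau_quotient_derive d0 d1 d2 ut tw.
have [_ +] := pI z uh.
rewrite /= (is_derive1E (tau_quotient_derive2 d0 d1 d2 d3 ut tz)).
rewrite (tau_quotientE d0 d1 ut tz) => e.
(* In u'' - 6 u^2 the terms in [t1 z ^+ 4] and [t0 z * t1 z ^+ 2 * t2 z] cancel, so the denominator
   [t0 z ^+ 4] drops to [t0 z ^+ 2]. *)
have {}e : 0 = 6 * lambda * z + g2 / 2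
  - (t0 z * t4 z - 4 * (t1 z * t3 z) + 3 * t2 z ^+ 2) / t0 z ^+ 2.
  have := subrr (6 * ((t1 z ^+ 2 - t0 z * t2 z) / t0 z ^+ 2) ^+ 2
    - 6 * lambda * z - g2 / 2).
  rewrite -{1}e => <-; by field.
apply/eqP; rewrite eq_sym -subr_eq0; apply/eqP.
rewrite -[RHS](mul0r (t0 z ^+ 2)) [in RHS]e; by field.
Unshelve. all: by end_near. Qed.

(** * Taylor coefficients of higher derivatives *)

Definition deriv_coefs (F : numFieldType) (a : nat -> F) (k : nat) : nat -> F :=
  fun n => a (n + k)%N *+ ((n + k) ^_ k).

Lemma deriv_coefs0 (F : numFieldType) (a : nat -> F) : deriv_coefs a 0 = a.
Proof. by apply/funext => n; rewrite /deriv_coefs addn0 ffactn0. Qed.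

Lemma deriv_coefsS (F : numFieldType) (a : nat -> F) k :
  deriv_coef (deriv_coefs a k) = deriv_coefs a k.+1.
Proof.
apply/funext => n; rewrite /deriv_coef /deriv_coefs addSnnS -mulrnA.
by rewrite ffactnSr -addSnnS addnK.
Qed.

Lemma power_sum_derivs (R : realType) (a : nat -> Cplx R) k f :
  power_sum (deriv_coefs a k) f -> exists g,
    power_sum (deriv_coefs a k.+1) g /\
    forall z : Cplx R, is_derive z 1 f (g z).
Proof.
move=> af; have [g] := power_sum_deriv af.
move=> ag; exists g; split; first by rewrite -deriv_coefsS.
exact: power_sum_is_derive ag.
Qed.

(** Multiplying the k-th derivative by z^k restores the original index; the terms with n < k are
    killed by the falling factorial. *)
Lemma power_sum_ffact (F : numFieldType) (a : nat -> F) k f :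
  power_sum (deriv_coefs a k) f ->
  power_sum (fun n => a n *+ (n ^_ k)) (fun z => z ^+ k * f z).
Proof.
move=> af z; rewrite -(cvg_shiftn k).
have -> : [sequence series (fun n => a n *+ n ^_ k * z ^+ n) (n + k)%N]_n =
    (fun n => z ^+ k * series (fun n => deriv_coefs a k n * z ^+ n) n).
  apply/funext => n; rewrite /series /= mulr_sumr.
  rewrite (@big_cat_nat _ _ _ k 0 (n + k))//= ?leq_addl//.
  rewrite big_nat big1 ?add0r => [|i /andP[_ ik]]; last first.
    by rewrite ffact_small// mulr0n mul0r.
  rewrite -[LHS]/(\sum_((0 + k)%N <= i < (n + k)%N) a i *+ i ^_ k * z ^+ i).
  rewrite big_addn addnK; apply: eq_bigr => i _.
  rewrite exprD /deriv_coefs !mulrnAl !mulrnAr.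
  by congr (_ *+ _); ring.
by apply: cvgM (af z); exact: cvg_cst.
Qed.

Lemma power_sum_at0 (F : numFieldType) (a : nat -> F) f :
  power_sum a f -> f 0 = a 0%N.
Proof.
move=> /(_ 0); rewrite -cvg_shiftS.
have -> : [sequence series (fun n => a n * 0 ^+ n) n.+1]_n = (fun=> a 0%N).
  apply/funext => n; rewrite /series /= big_nat_recl//= expr0 mulr1.
  by rewrite big1 ?addr0// => i _; rewrite expr0n mulr0.
by move=> af; rewrite -(cvg_lim (@norm_hausdorff _ _) af) lim_cst.
Qed.

Lemma power_sum_coef1 (R : realType) (a : nat -> Cplx R) f :
  power_sum a f -> a 1%N = derive1 f 0.
Proof.
rewrite -{1}(deriv_coefs0 a) => af; have [g [ag fg]] := power_sum_derivs af.
by rewrite (is_derive1E (fg 0)) (power_sum_at0 ag) /deriv_coefs ffactn1.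
Qed.

(** The linear term dominates the quadratic remainder near 0, so a simple zero is isolated. *)
Lemma expansion_at0_neq0 (F : numFieldType) (f : F -> F) (p : {poly F}) :
  expansion_at0 1 f p -> p`_0 = 0 -> p`_1 != 0 -> (size p <= 2)%N ->
  \forall z \near (0 : F)^', f z != 0.
Proof.
move=> [M M0 fp] p0 p1 sp.
have d0 : 0 < `|p`_1| / (M + 1) by rewrite divr_gt0 ?normr_gt0// ltr_wpDl.
near=> z; apply/eqP => fz.
have zn0 : z != 0 by near: z; exact: nbhs_dnbhs_neq.
have zd : `|z| < `|p`_1| / (M + 1) by near: z; exact: dnbhs0_lt.
have : `|f z - p.[z]| <= M * `|z| ^+ 2 by near: z.
rewrite fz sub0r normrN (horner_coef_wide _ sp) !big_ord_recl big_ord0 /= p0.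
rewrite mul0r add0r addr0 expr1 normrM expr2 mulrA ler_pM2r ?normr_gt0//.
have lt : M * `|z| < `|p`_1|.
  apply: le_lt_trans (_ : (M + 1) * `|z| < _).
    by rewrite ler_wpM2r// lerDl.
  by rewrite mulrC -ltr_pdivlMr// ltr_wpDl.
by move=> /le_lt_trans /(_ lt); rewrite ltxx.
Unshelve. all: by end_near. Qed.

(** * The bilinear equation in terms of Taylor coefficients *)

(** Because 4! C(j,r) C(k,4-r) is C(4,r) times the falling factorials of j and k of orders r and
    4-r, [bcoef j k] is the factor that Hirota's operator D^4 produces on the pair z^j, z^k. *)
Lemma bcoefE (F : numFieldType) j k : (bcoef j k)%:~R =
  (k ^_ 4)%:R - 4 * (j%:R * (k ^_ 3)%:R) + 6 * ((j ^_ 2)%:R * (k ^_ 2)%:R)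
  - 4 * ((j ^_ 3)%:R * k%:R) + (j ^_ 4)%:R :> F.
Proof.
have -> : bcoef j k = 24%:Z * ('C(k, 4)%:Z - 'C(j, 1)%:Z * 'C(k, 3)%:Z
    + 'C(j, 2)%:Z * 'C(k, 2)%:Z - 'C(j, 3)%:Z * 'C(k, 1)%:Z + 'C(j, 4)%:Z).
  rewrite /bcoef !big_ord_recl big_ord0 /= !bin0.
  rewrite -[LHS]/(24%:Z * ((-1) ^+ 0 * 1 * 'C(k, 4)%:Z
    + ((-1) ^+ 1 * 'C(j, 1)%:Z * 'C(k, 3)%:Z
    + ((-1) ^+ 2 * 'C(j, 2)%:Z * 'C(k, 2)%:Z
    + ((-1) ^+ 3 * 'C(j, 3)%:Z * 'C(k, 1)%:Z
    + ((-1) ^+ 4 * 'C(j, 4)%:Z * 1%:Z + 0)))))).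
  by ring.
rewrite -!bin_ffact !bin1.
rewrite (_ : 4`! = 24)%N// (_ : 3`! = 6)%N// (_ : 2`! = 2)%N//.
rewrite !natrM !(intrM, intrD, intrN) -!pmulrn.
by ring.
Qed.

(** The coefficient of z^N in z^4 times the bilinear equation. On the right, tau^2 is multiplied by
    z^5 and by z^4, hence the shifts by 5 and 4 and the zeros for small [N]. *)
Lemma tau_coef_identity (R : realType) (g2 lambda : Cplx R)
    (u tau : Cplx R -> Cplx R) (a : nat -> Cplx R) N :
  power_sum a tau -> normalized_tau u tau -> painleve1_equation g2 lambda u ->
  \sum_(j < N.+1) (bcoef j (N - j))%:~R * (a j * a (N - j)%N) =
  2 * (6 * lambda * (if (N < 5)%N then 0
                     else \sum_(j < (N - 5).+1) a j * a (N - 5 - j)%N)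
     + g2 / 2 * (if (N < 4)%N then 0
                 else \sum_(j < (N - 4).+1) a j * a (N - 4 - j)%N)).
Proof.
move=> a0 [[_ _ ut] [tau0 tau'0 _]] pI.
have := a0; rewrite -{1}(deriv_coefs0 a) => b0.
have [t1 [a1 d0]] := power_sum_derivs b0.
have [t2 [a2 d1]] := power_sum_derivs a1.
have [t3 [a3 d2]] := power_sum_derivs a2.
have [t4 [a4 d3]] := power_sum_derivs a3.
have a00 : a 0%N = 0 by rewrite -(power_sum_at0 a0).
have a10 : a 1%N = 1 by rewrite (power_sum_coef1 a0).
have exp k f : power_sum (deriv_coefs a k) f ->
    expansion_at0 N (fun z => z ^+ k * f z)
      (\poly_(i < N.+1) (a i *+ (i ^_ k))).
  move=> /power_sum_ffact af; apply: power_series_expansion.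
  by near=> z; exact: af.
have := exp _ _ b0; have := exp _ _ a1; have := exp _ _ a2.
have := exp _ _ a3; have := exp _ _ a4.
set Q4 := \poly_(_ < _) _; set Q3 := \poly_(_ < _) _; set Q2 := \poly_(_ < _) _.
set Q1 := \poly_(_ < _) _; set Q0 := \poly_(_ < _) _ => e4 e3 e2 e1 e0.
(* The bilinear equation is multiplied by z^4: the coefficients of
   z^k tau^(k) are those of tau times [i ^_ k], without index shift. *)
have eX : expansion_at0 N
   (fun z => ((6 * lambda) *: 'X^5 + (g2 / 2) *: 'X^4).[z])
   ((6 * lambda) *: 'X^5 + (g2 / 2) *: 'X^4) by exact: expansion_at0_poly.
have E := expansion_at0D (expansion_at0D (expansion_at0D
  (expansion_at0M e0 e4) (expansion_at0Z (-4) (expansion_at0M e1 e3)))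
  (expansion_at0Z 3 (expansion_at0M e2 e2)))
  (expansion_at0Z (-1) (expansion_at0M eX (expansion_at0M e0 e0))).
(* [tau_bilinear] holds only off the zeros of tau, so the zero at the origin has to be isolated. *)
have tn0 : \forall z \near (0 : Cplx R)^', tau z != 0.
  apply: (@expansion_at0_neq0 _ _ (\poly_(i < 2) a i)).
  - by apply: power_series_expansion; near=> z; exact: a0.
  - by rewrite coef_poly.
  - by rewrite coef_poly /= a10 oner_neq0.
  - exact: size_poly.
have QM k l i : (i <= N)%N ->
    ((\poly_(i < N.+1) (a i *+ (i ^_ k)))
      * (\poly_(i < N.+1) (a i *+ (i ^_ l))))`_i
    = \sum_(j < i.+1) a j * a (i - j)%N * ((j ^_ k)%:R * ((i - j) ^_ l)%:R).
  move=> iN; rewrite coefM; apply: eq_bigr => j _; rewrite !coef_poly.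
  have ji : (j <= i)%N by rewrite -ltnS.
  rewrite ltnS (leq_trans ji iN) ltnS (leq_trans (leq_subr _ _) iN).
  by rewrite -[in LHS]mulr_natr -[a (i - j)%N *+ _]mulr_natr mulrACA.
have QM0 i : (i <= N)%N -> (Q0 * Q0)`_i = \sum_(j < i.+1) a j * a (i - j)%N.
  move=> iN; rewrite QM//; apply: eq_bigr => j _.
  by rewrite !ffactn0 !mulr1.
(* The coefficient of z^N in the product of z^k tau^(k) and z^l tau^(l); reversing the sum makes it
   symmetric in [k] and [l]. *)
pose S k l := \sum_(j < N.+1)
  a j * a (N - j)%N * ((j ^_ k)%:R * ((N - j) ^_ l)%:R).
have SC k l : S k l = S l k.
  rewrite /S (reindex_inj rev_ord_inj) /=; apply: eq_bigr => j _.
  rewrite subSS subKn -1?ltnS//.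
  by rewrite [a (N - j)%N * _]mulrC [(_ ^_ k)%:R * _]mulrC.
(* By symmetry the weights 1, -4, 6, -4, 1 fold into twice 1, -4, 3, which is the left-hand side of
   the bilinear equation. *)
have SE : \sum_(j < N.+1) (bcoef j (N - j))%:~R * (a j * a (N - j)%N) =
    2 * (S 0%N 4%N - 4 * S 1%N 3%N + 3 * S 2%N 2%N).
  transitivity (S 0%N 4%N - 4 * S 1%N 3%N + 6 * S 2%N 2%N
    - 4 * S 3%N 1%N + S 4%N 0%N).
    rewrite /S !mulr_sumr -!sumrN -!big_split /=.
    by apply: eq_bigr => j _; rewrite bcoefE !ffactn0 !ffactn1; ring.
  by rewrite (SC 3%N) (SC 4%N); ring.
rewrite SE; congr (2 * _).
have cX : (((6 * lambda) *: 'X^5 + (g2 / 2) *: 'X^4) * (Q0 * Q0))`_N =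
    6 * lambda * (if (N < 5)%N then 0
                  else \sum_(j < (N - 5).+1) a j * a (N - 5 - j)%N)
    + g2 / 2 * (if (N < 4)%N then 0
                else \sum_(j < (N - 4).+1) a j * a (N - 4 - j)%N).
  rewrite mulrDl -(scalerAl (6 * lambda)) -(scalerAl (g2 / 2)).
  rewrite coefD !coefZ !coefXnM.
  by case: ifP; case: ifP => *; rewrite ?QM0 ?leq_subr.
have G0 := expansion_at0_eq0 E _ (leqnn N).
rewrite -cX; apply/eqP; rewrite -subr_eq0; apply/eqP.
rewrite -[RHS]G0; last first.
  near=> z.
  have tz : tau z != 0 by near: z.
  have := tau_bilinear d0 d1 d2 d3 ut pI tz.
  rewrite hornerD !hornerZ !hornerXn => bil.
  transitivity (z ^+ 4 * ((tau z * t4 z - 4 * (t1 z * t3 z) + 3 * t2 z ^+ 2)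
     - (6 * lambda * z + g2 / 2) * tau z ^+ 2)); first by ring.
  by rewrite bil subrr mulr0.
rewrite !coefD !coefZ !QM// -!/(S _ _); ring.
Unshelve. all: by end_near. Qed.

(** * The free Laurent coefficient of u and the resonance *)

Lemma laurent_power_series (R : realType) (c : nat -> Cplx R) u :
  laurent_at0 c u ->
  \forall z \near (0 : Cplx R)^',
    series (fun n => c n * z ^+ n) @ \oo --> z ^+ 2 * u z.
Proof.
move=> cu; near=> z.
have z0 : z != 0 by near: z; exact: nbhs_dnbhs_neq.
have uz : series (fun n : nat => c n * z ^ (n%:Z - 2)) @ \oo --> u z by near: z.
have -> : series (fun n => c n * z ^+ n) =
    (fun N => z ^+ 2 * series (fun n : nat => c n * z ^ (n%:Z - 2)) N).
  apply/funext => N; rewrite /series /= mulr_sumr; apply: eq_bigr => n _.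
  rewrite expfzDr// -[z ^ n]/(z ^+ n) -[z ^ (-2)]/((z ^+ 2)^-1).
  by field; exact: z0.
by apply: cvgM uz; exact: cvg_cst.
Unshelve. all: by end_near. Qed.

(* The coefficient of z^8 in z^2 u tau^2 = (z tau')^2 - tau (z^2 tau''). *)
Lemma laurent_coef6 (R : realType) (u tau : Cplx R -> Cplx R)
    (a c : nat -> Cplx R) :
  power_sum a tau -> tau_function u tau -> laurent_at0 c u -> c 0%N = 1 ->
  a 1%N = 1 -> (forall n, (n <= 8)%N -> n != 1%N -> n != 7%N -> a n = 0) ->
  c 6%N = - 30 * a 7%N.
Proof.
move=> a0 [_ _ ut] cu c0 a1E az.
have := a0; rewrite -{1}(deriv_coefs0 a) => b0.
have [t1 [a1 d0]] := power_sum_derivs b0.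
have [t2 [a2 d1]] := power_sum_derivs a1.
(* Up to degree 8, tau is z + a_7 z^7, so each z^k tau^(k) is represented by two monomials. *)
have exp k f : power_sum (deriv_coefs a k) f ->
    expansion_at0 8 (fun z => z ^+ k * f z)
      ((1 ^_ k)%:R *: 'X + (a 7%N *+ (7 ^_ k)) *: 'X^7).
  have -> : ((1 ^_ k)%:R *: 'X + (a 7%N *+ (7 ^_ k)) *: 'X^7) =
      \poly_(i < 9) (a i *+ (i ^_ k)).
    apply/polyP => i; rewrite coefD !coefZ coefX coefXn coef_poly.
    have [->|i1] := eqVneq i 1%N; first by rewrite a1E /= mulr1 mulr0 addr0.
    have [->|i7] := eqVneq i 7%N; first by rewrite /= mulr1 mulr0 add0r.
    rewrite !mulr0 addr0; case: ltnP => // i9.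
    by rewrite az// mul0rn.
  move=> /power_sum_ffact af; apply: power_series_expansion.
  by near=> z; exact: af.
have e0 := exp _ _ b0; have e1 := exp _ _ a1; have e2 := exp _ _ a2.
have eu := power_series_expansion 8 (laurent_power_series cu).
have E := expansion_at0D (expansion_at0D
  (expansion_at0M eu (expansion_at0M e0 e0))
  (expansion_at0Z (-1) (expansion_at0M e1 e1)))
  (expansion_at0M e0 e2).
have tn0 : \forall z \near (0 : Cplx R)^', tau z != 0.
  apply: (@expansion_at0_neq0 _ _ (\poly_(i < 2) a i)).
  - by apply: power_series_expansion; near=> z; exact: a0.
  - by rewrite coef_poly az.
  - by rewrite coef_poly /= a1E oner_neq0.
  - exact: size_poly.
have := expansion_at0_eq0 E _ (leqnn 8).
set C := \poly_(i < 9) c i.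
move=> G0; have {}G0 := G0 _.
(* The products written out. In degree 8 only c_6 + 2 a_7 c_0 - 14 a_7 + 42 a_7 remains, which is
   c_6 + 30 a_7 because c_0 = 1. *)
have : (C * 'X^2 + (2 * a 7%N) *: (C * 'X^8) + (a 7%N ^+ 2) *: (C * 'X^14)
  - 'X^2 - (14 * a 7%N) *: 'X^8 - (49 * a 7%N ^+ 2) *: 'X^14
  + (42 * a 7%N) *: 'X^8 + (42 * a 7%N ^+ 2) *: 'X^14)`_8 = 0.
  rewrite -[RHS]G0.
    apply: (congr1 (fun p : {poly Cplx R} => p`_8)).
    rewrite -!mul_polyC !(polyCMn, polyCM, polyC_exp).
    rewrite !ffactn0 !ffactn1 (_ : 1 ^_ 2 = 0)%N// (_ : 7 ^_ 2 = 42)%N//.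
    rewrite !(polyCN, polyC1, mulr1n); ring.
  near=> z.
  have tz : tau z != 0 by near: z.
  rewrite (tau_quotientE d0 d1 ut tz); field; exact: tz.
rewrite !(coefD, coefN, coefZ, coefMXn, coefXn) /= !coef_poly /= c0 => h.
apply/eqP; rewrite -subr_eq0 -[X in _ == X]h; apply/eqP; ring.
Unshelve. all: by end_near. Qed.

(** * Polynomials in three parameters *)

Lemma poly_nat_eq0 (D : idomainType) (p : {poly D}) :
  injective (fun k : nat => k%:R : D) ->
  (forall k : nat, p.[k%:R] = 0) -> p = 0.
Proof.
move=> injD p0; apply/eqP; apply: contraT => pn0.
have := max_poly_roots (rs := [seq k%:R | k <- iota 0 (size p)]) pn0.
rewrite size_map size_iota ltnn; apply.
  by apply/allP => _ /mapP[k _ ->]; rewrite /root p0.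
by rewrite map_inj_uniq ?iota_uniq.
Qed.

(** Lets [poly_nat_eq0] be applied again over a ring of polynomials. *)
Lemma natr_inj_poly (D : nzRingType) :
  injective (fun k : nat => k%:R : D) ->
  injective (fun k : nat => k%:R : {poly D}).
Proof.
by move=> injD i j; rewrite -!(rmorph_nat (@polyC D)) => /polyC_inj /injD.
Qed.

Notation poly3 F := {poly {poly {poly F}}}.

(** Natural numbers are enough for an identity principle, and [x%:R] makes sense as a constant in
    each of the nested rings. *)
Definition eval3 (F : numFieldType) (x y w : nat) (p : poly3 F) : F :=
  p.[x%:R].[y%:R].[w%:R].

Lemma eval3B (F : numFieldType) x y w (p q : poly3 F) :
  eval3 x y w (p - q) = eval3 x y w p - eval3 x y w q.
Proof. by rewrite /eval3 !(hornerD, hornerN). Qed.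

Lemma eval3D (F : numFieldType) x y w (p q : poly3 F) :
  eval3 x y w (p + q) = eval3 x y w p + eval3 x y w q.
Proof. by rewrite /eval3 !hornerD. Qed.

Lemma eval3M (F : numFieldType) x y w (p q : poly3 F) :
  eval3 x y w (p * q) = eval3 x y w p * eval3 x y w q.
Proof. by rewrite /eval3 !hornerM. Qed.

Lemma eval3_sum (F : numFieldType) x y w (I : finType) (f : I -> poly3 F) :
  eval3 x y w (\sum_i f i) = \sum_i eval3 x y w (f i).
Proof. by rewrite /eval3 !horner_sum. Qed.

Lemma eval3Mz (F : numFieldType) x y w (p : poly3 F) k :
  eval3 x y w (p *~ k) = eval3 x y w p *~ k.
Proof.
by case: k => k; rewrite ?NegzE ?mulrNz -!pmulrn /eval3 ?hornerN !hornerMn.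
Qed.

Lemma horner_natr (D : comNzRingType) (k : nat) (c : D) :
  (k%:R : {poly D}).[c] = k%:R.
Proof. exact: (rmorph_nat (horner_eval c)). Qed.

Lemma eval3Xl (F : numFieldType) x y w : eval3 x y w 'X = x%:R :> F.
Proof. by rewrite /eval3 hornerX !horner_natr. Qed.

Lemma eval3Xm (F : numFieldType) x y w : eval3 x y w 'X%:P = y%:R :> F.
Proof. by rewrite /eval3 hornerC hornerX horner_natr. Qed.

(** The one-variable principle is applied to each variable in turn, the coefficients being
    polynomials in the remaining ones. *)
Lemma poly3_eq0 (F : numFieldType) (p : poly3 F) :
  (forall x y w : nat, eval3 x y w p = 0) -> p = 0.
Proof.
have i0 : injective (fun k : nat => k%:R : F).
  by move=> i j /eqP; rewrite eqr_nat => /eqP.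
have i1 := natr_inj_poly i0; have i2 := natr_inj_poly i1.
move=> p0; apply: poly_nat_eq0 => // x; apply: poly_nat_eq0 => // y.
by apply: poly_nat_eq0 => // w; exact: p0.
Qed.

Definition coef3 (F : numFieldType) l m n (p : poly3 F) : F := p`_l`_m`_n.

(* The Taylor coefficient of z^N of tau, as a polynomial in g2/2 (outermost
   variable), 6 lambda and 2 g3 (innermost variable). *)
Definition weight_poly (F : numFieldType) (e : triple -> F) (N : nat) :
    poly3 F :=
  \poly_(l < N.+1) \poly_(m < N.+1) \poly_(n < N.+1)
    (if sdeg (l, m, n) == N then e (l, m, n) else 0).

(** The bounds in [weight_poly] cut nothing off: [sdeg (l, m, n) = N] forces [l], [m] and [n] below
    [N]. *)
Lemma weight_polyE (F : numFieldType) (e : triple -> F) N l m n :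
  coef3 l m n (weight_poly e N) =
  if sdeg (l, m, n) == N then e (l, m, n) else 0.
Proof.
rewrite /coef3 coef_poly.
case: ltnP => [_|lN]; last first.
  by rewrite !coef0; case: eqP => //; rewrite /sdeg; lia.
rewrite coef_poly; case: ltnP => [_|lN]; last first.
  by rewrite !coef0; case: eqP => //; rewrite /sdeg; lia.
rewrite coef_poly; case: ltnP => [_|lN] //.
by case: eqP => //; rewrite /sdeg; lia.
Qed.

Lemma eval3_weight_poly (F : numFieldType) (e : triple -> F) N x y w :
  eval3 x y w (weight_poly e N) =
  \sum_(l < N.+1) \sum_(m < N.+1)
    \sum_(n < N.+1 | sdeg (l : nat, m : nat, n : nat) == N)
      e (l : nat, m : nat, n : nat) * x%:R ^+ l * y%:R ^+ m * w%:R ^+ n.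
Proof.
rewrite /eval3 horner_poly !horner_sum; apply: eq_bigr => l _.
rewrite !hornerM !horner_exp !horner_natr horner_poly horner_sum mulr_suml.
apply: eq_bigr => m _.
rewrite !hornerM !horner_exp !horner_natr horner_poly !mulr_suml.
rewrite [RHS]big_mkcond.
by apply: eq_bigr => n _; case: ifP => _; ring.
Qed.

Definition splits (F : numFieldType) (G : triple -> triple -> F)
    (l m n : nat) : F :=
  \sum_(l1 < l.+1) \sum_(m1 < m.+1) \sum_(n1 < n.+1)
    G (l1 : nat, m1 : nat, n1 : nat) (l - l1, m - m1, n - n1)%N.

Lemma coef3M (F : numFieldType) (p q : poly3 F) l m n :
  coef3 l m n (p * q) =
  \sum_(l1 < l.+1) \sum_(m1 < m.+1) \sum_(n1 < n.+1)
    coef3 l1 m1 n1 p * coef3 (l - l1) (m - m1) (n - n1) q.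
Proof.
rewrite /coef3 coefM !coef_sum; apply: eq_bigr => l1 _.
rewrite coefM coef_sum; apply: eq_bigr => m1 _.
by rewrite coefM.
Qed.

Lemma coef3Mz (F : numFieldType) (p : poly3 F) k l m n :
  coef3 l m n (p *~ k) = coef3 l m n p *~ k.
Proof.
by case: k => k; rewrite ?NegzE ?mulrNz -!pmulrn /coef3 ?coefN !coefMn.
Qed.

Lemma coef3D (F : numFieldType) (p q : poly3 F) l m n :
  coef3 l m n (p + q) = coef3 l m n p + coef3 l m n q.
Proof. by rewrite /coef3 !coefD. Qed.

Lemma coef3_sum (F : numFieldType) (I : finType) (f : I -> poly3 F) l m n :
  coef3 l m n (\sum_i f i) = \sum_i coef3 l m n (f i).
Proof. by rewrite /coef3 !coef_sum. Qed.

(** [weight_poly e j] contains only monomials with [sdeg] equal to [j], so each splitting of the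
    exponents meets a single [j]. A general weight [b] serves both the bilinear side and, with [b]
    constantly 1, the square of tau. *)
Lemma coef3_weight_conv (F : numFieldType) (e : triple -> F)
    (b : nat -> nat -> int) l m n N :
  N = (sdeg (l, m, n)).+1 ->
  coef3 l m n
    (\sum_(j < N.+1)
      (weight_poly e j * weight_poly e (N - j)) *~ b j (N - j)%N) =
  splits (fun i1 i2 => (e i1 * e i2) *~ b (sdeg i1) (sdeg i2)) l m n.
Proof.
move=> NE; rewrite coef3_sum /splits.
under eq_bigr do rewrite coef3Mz coef3M mulrz_suml.
rewrite exchange_big; apply: eq_bigr => l1 _ /=.
under eq_bigr do rewrite mulrz_suml.
rewrite exchange_big; apply: eq_bigr => m1 _ /=.
under eq_bigr do rewrite mulrz_suml.
rewrite exchange_big; apply: eq_bigr => n1 _ /=.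
(* Each [sdeg] carries its own +1, so the degrees of the two factors add up to one more than
   [sdeg (l, m, n)]. *)
have sE : (sdeg (l1 : nat, m1 : nat, n1 : nat)
    + sdeg (l - l1, m - m1, n - n1) = N)%N.
  rewrite NE /sdeg; have := ltn_ord l1; have := ltn_ord m1; have := ltn_ord n1.
  lia.
set s1 := sdeg _ in sE *; set s2 := sdeg _ in sE *.
have s1N : (s1 < N.+1)%N by lia.
rewrite (bigD1 (Ordinal s1N)) //= big1 ?addr0.
  rewrite !weight_polyE -/s1 -/s2 eqxx.
  have -> : (N - s1)%N = s2 by lia.
  by rewrite eqxx.
move=> j; rewrite !weight_polyE -/s1 -val_eqE /= eq_sym => /negbTE ->.
by rewrite mul0r mul0rz.
Qed.

Lemma coef3Xl (F : numFieldType) (p : poly3 F) l m n :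
  coef3 l m n ('X * p) = if l is l'.+1 then coef3 l' m n p else 0.
Proof. by rewrite /coef3 coefXM; case: l => [|l] //=; rewrite !coef0. Qed.

Lemma coef3Xm (F : numFieldType) (p : poly3 F) l m n :
  coef3 l m n ('X%:P * p) = if m is m'.+1 then coef3 l m' n p else 0.
Proof.
by rewrite /coef3 coefCM coefXM; case: m => [|m] //=; rewrite !coef0.
Qed.

(** * Identities between the coefficients of tau *)

Definition taylor (A : triple -> rat) (i : triple) : rat := A i / (sdeg i)`!%:R.

Section TauCoefficients.
Variables (R : realType)
  (u tau : Cplx R -> Cplx R -> Cplx R -> Cplx R -> Cplx R)
  (A : triple -> rat).
Hypotheses (Hu : forall g2 lambda g3 : Cplx R,
     painleve1_solution g2 lambda g3 (u g2 lambda g3))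
  (Htau : forall g2 lambda g3 : Cplx R,
     normalized_tau (u g2 lambda g3) (tau g2 lambda g3))
  (HA : forall g2 lambda g3 : Cplx R,
     tau_expansion A g2 lambda g3 (tau g2 lambda g3)).

Let e (i : triple) : Cplx R := ratr (taylor A i).

(** The parameters are chosen so that g2/2, 6 lambda and 2 g3 become the natural numbers [x], [y]
    and [w]. *)
Lemma tau_power_sum (x y w : nat) :
  power_sum (fun N => eval3 x y w (weight_poly e N))
    (tau (2 * x%:R) (y%:R / 6) (w%:R / 2)).
Proof.
move=> z.
suff -> : (fun n => eval3 x y w (weight_poly e n) * z ^+ n) =
  (fun N => \sum_(l < N.+1) \sum_(m < N.+1)
        \sum_(n < N.+1 | sdeg (l : nat, m : nat, n : nat) == N)
          tau_term A (2 * x%:R) (y%:R / 6) (w%:R / 2) z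
            (l : nat, m : nat, n : nat)) by exact: HA.
apply/funext => N; rewrite eval3_weight_poly mulr_suml; apply: eq_bigr => l _.
rewrite mulr_suml; apply: eq_bigr => m _; rewrite mulr_suml.
apply: eq_bigr => n /eqP sN; rewrite /tau_term sN /e /taylor sN.
rewrite [ratr (_ / _)]fmorph_div rmorph_nat /=.
have h6 : 6 * (y%:R / 6) = y%:R :> Cplx R by rewrite mulrC divfK ?pnatr_eq0.
have h2 : 2 * (w%:R / 2) = w%:R :> Cplx R by rewrite mulrC divfK ?pnatr_eq0.
rewrite h6 h2 mulKf ?pnatr_eq0//.
by ring.
Qed.

(** Both sides agree at all natural values of the parameters, hence as polynomials. The factor
    [*~ 1] gives the square of tau the shape required by [coef3_weight_conv]. *)
Lemma weight_poly_identity N :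
  \sum_(j < N.+1) (weight_poly e j * weight_poly e (N - j)) *~ bcoef j (N - j)
  = ('X%:P * (if (N < 5)%N then 0 else \sum_(j < (N - 5).+1)
       (weight_poly e j * weight_poly e (N - 5 - j)) *~ 1)
   + 'X * (if (N < 4)%N then 0 else \sum_(j < (N - 4).+1)
       (weight_poly e j * weight_poly e (N - 4 - j)) *~ 1)) *~ 2.
Proof.
apply/eqP; rewrite -subr_eq0; apply/eqP; apply: poly3_eq0 => x y w.
have [_ pI _] := Hu (2 * x%:R) (y%:R / 6) (w%:R / 2).
have := tau_coef_identity N (@tau_power_sum x y w) (Htau _ _ _) pI.
have h6 : 6 * (y%:R / 6) = y%:R :> Cplx R by rewrite mulrC divfK ?pnatr_eq0.
have h2 : 2 * x%:R / 2 = x%:R :> Cplx R by rewrite mulrC mulKf ?pnatr_eq0.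
rewrite h6 h2.
move=> bil; rewrite eval3B eval3Mz eval3D !eval3M eval3Xl eval3Xm.
have evs (M : nat) (b : nat -> nat -> int) :
    eval3 x y w (\sum_(j < M.+1)
      (weight_poly e j * weight_poly e (M - j)) *~ b j (M - j)%N) =
    \sum_(j < M.+1) (b j (M - j)%N)%:~R *
      (eval3 x y w (weight_poly e j) * eval3 x y w (weight_poly e (M - j))).
  rewrite eval3_sum; apply: eq_bigr => j _.
  by rewrite eval3Mz eval3M mulrzl.
rewrite evs bil.
have evi (M k : nat) : eval3 x y w
    (if (M < k)%N then 0 else \sum_(j < (M - k).+1)
      (weight_poly e j * weight_poly e (M - k - j)) *~ 1) =
    if (M < k)%N then 0 else \sum_(j < (M - k).+1)
      eval3 x y w (weight_poly e j) * eval3 x y w (weight_poly e (M - k - j)).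
  case: ifP => _; first by rewrite /eval3 !horner0.
  rewrite (evs _ (fun _ _ => 1)); apply: eq_bigr => j _; exact: mul1r.
by rewrite !evi -mulrzl subrr.
Qed.

(** Comparison of the coefficients of one monomial in degree N = [sdeg (l, m, n)] + 1, brought down
    from the complex numbers to the rationals by injectivity of [ratr]. *)
Lemma taylor_identity l m n :
  sum_splits (fun i1 i2 =>
      (bcoef (sdeg i1) (sdeg i2))%:~R * (taylor A i1 * taylor A i2)) l m n =
  2 * ((if m is m'.+1 then
          sum_splits (fun i1 i2 => taylor A i1 * taylor A i2) l m' n
        else 0)
     + (if l is l'.+1 then
          sum_splits (fun i1 i2 => taylor A i1 * taylor A i2) l' m n
        else 0)).
Proof.
have rs (b : nat -> nat -> int) l' m' n' :
    ratr (sum_splits (fun i1 i2 =>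
      (b (sdeg i1) (sdeg i2))%:~R * (taylor A i1 * taylor A i2)) l' m' n') =
    splits (fun i1 i2 => (e i1 * e i2) *~ b (sdeg i1) (sdeg i2)) l' m' n'.
  rewrite /sum_splits /splits !rmorph_sum; apply: eq_bigr => l1 _.
  rewrite !rmorph_sum; apply: eq_bigr => m1 _.
  rewrite !rmorph_sum; apply: eq_bigr => n1 _.
  rewrite rmorphM rmorph_int mulrzl; congr (_ *~ _); exact: rmorphM.
have rs1 l' m' n' :
    ratr (sum_splits (fun i1 i2 => taylor A i1 * taylor A i2) l' m' n') =
    splits (fun i1 i2 => (e i1 * e i2) *~ 1) l' m' n'.
  rewrite -(rs (fun _ _ => 1)); congr (ratr (sum_splits _ _ _ _)).
  by apply/funext => i1; apply/funext => i2; rewrite mul1r.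
have ratrI : injective (ratr : rat -> Cplx R) by exact: fmorph_inj.
apply: ratrI.
rewrite [LHS](rs bcoef) -(coef3_weight_conv e bcoef (erefl _)).
rewrite weight_poly_identity coef3Mz coef3D coef3Xm coef3Xl -mulrzl.
have r2 (x : rat) : ratr (2 * x) = 2 * ratr x :> Cplx R.
  by rewrite rmorphM; congr (_ * _); exact: rmorph_nat.
rewrite r2 -[2%:~R]/(2 : Cplx R).
apply: (congr1 (fun x => 2 * x)); rewrite raddfD /=.
apply: (congr2 (fun x y => x + y)).
  (* Lowering [m] by one lowers [sdeg] by 5, so N - 5 is again one more than the new [sdeg]; for [l]
     the shift is 4. *)
  case: m => [|m]; first by rewrite /= rmorph0.
  rewrite /= [RHS]rs1 ifF; last by rewrite /sdeg; lia.
  by apply: (@coef3_weight_conv _ e (fun _ _ => 1)); rewrite /sdeg; lia.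
case: l => [|l]; first by rewrite /= rmorph0.
rewrite /= [RHS]rs1 ifF; last by rewrite /sdeg; lia.
by apply: (@coef3_weight_conv _ e (fun _ _ => 1)); rewrite /sdeg; lia.
Qed.
End TauCoefficients.

(** * The two initial values *)

Lemma eval3_weight_poly00 (F : numFieldType) (e : triple -> F) N w :
  eval3 0 0 w (weight_poly e N) =
  \sum_(n < N.+1 | (6 * n + 1)%N == N) e (0%N, 0%N, n : nat) * w%:R ^+ n.
Proof.
rewrite eval3_weight_poly big_ord_recl [X in _ + X]big1 ?addr0; last first.
  move=> l _; rewrite big1// => m _; rewrite big1// => n _.
  by rewrite lift0 expr0n mulr0 !mul0r.
rewrite big_ord_recl [X in _ + X]big1 ?addr0; last first.
  move=> m _; rewrite big1// => n _.
  by rewrite lift0 [_ ^+ _.+1]expr0n mulr0 mul0r.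
apply: eq_big => [n|n _] /=; first by rewrite !muln0.
by rewrite !expr0 !mulr1.
Qed.

Lemma tau_A000 (R : realType) u tau A
  (Htau : forall g2 lambda g3 : Cplx R,
     normalized_tau (u g2 lambda g3) (tau g2 lambda g3))
  (HA : forall g2 lambda g3 : Cplx R,
     tau_expansion A g2 lambda g3 (tau g2 lambda g3)) :
  A (0, 0, 0)%N = 1.
Proof.
have /power_sum_coef1 := @tau_power_sum _ _ _ HA 0 0 0.
have [_ [_ -> _]] := Htau (2 * 0%:R) (0%:R / 6) (0%:R / 2).
rewrite eval3_weight_poly00 (big_pred1 ord0) => [|[[|[|n]] ?]//].
rewrite expr0 mulr1 /taylor divr1 => h.
have ratrI : injective (ratr : rat -> Cplx R) by exact: fmorph_inj.
by apply: ratrI; rewrite h rmorph1.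
Qed.

(** With g2 = lambda = 0 and g3 = 1/2, tau has terms only in degrees 1 modulo 6, as [laurent_coef6]
    requires. Then c_6 = 1/56 equals -30 [A (0, 0, 1)] / 7!. *)
Lemma tau_A001 (R : realType) u tau A
  (Hu : forall g2 lambda g3 : Cplx R,
     painleve1_solution g2 lambda g3 (u g2 lambda g3))
  (Htau : forall g2 lambda g3 : Cplx R,
     normalized_tau (u g2 lambda g3) (tau g2 lambda g3))
  (HA : forall g2 lambda g3 : Cplx R,
     tau_expansion A g2 lambda g3 (tau g2 lambda g3)) :
  A (0, 0, 1)%N = - 3.
Proof.
have [_ _ [c [c0 c6 cu]]] := Hu (2 * 0%:R) (0%:R / 6) (1%:R / 2).
have [tu [_ t'0 _]] := Htau (2 * 0%:R) (0%:R / 6) (1%:R / 2).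
have ps := @tau_power_sum _ _ _ HA 0 0 1.
have a1 := power_sum_coef1 ps.
have := laurent_coef6 ps tu cu c0; rewrite a1 t'0 c6 => /(_ (erefl _)).
rewrite eval3_weight_poly00 (big_pred1 (Ordinal (isT : (1 < 8)%N))); last first.
  by move=> n /=; rewrite -[RHS]val_eqE /=; lia.
rewrite expr1 mulr1 => h.
have {}h : 1 / 2 / 28 = - 30 * ratr (taylor A (0, 0, 1)%N) :> Cplx R.
  rewrite h// => n n8 n1 n7; rewrite eval3_weight_poly00 big_pred0// => k /=.
  by lia.
have ratrI : injective (ratr : rat -> Cplx R) by exact: fmorph_inj.
have {}h : 56 * (30 * taylor A (0, 0, 1)%N) = - 1.
  move: (taylor A _) h => t h; apply: ratrI.
  have r56 : ratr 56 = 56 :> Cplx R by exact: ratr_nat.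
  have r30 : ratr 30 = 30 :> Cplx R by exact: ratr_nat.
  have rN1 : ratr (- 1) = - 1 :> Cplx R by exact: rmorphN1.
  rewrite rmorphM /= r56 [ratr (_ * _)]rmorphM /= r30 rN1.
  have -> : 56 * (30 * ratr t) = - 56 * (- 30 * ratr t) :> Cplx R by ring.
  by rewrite -h; field.
have tE : taylor A (0, 0, 1)%N =
    A (0, 0, 1)%N / (7 * (6 * (5 * (4 * (3 * 2))))).
  by rewrite /taylor [sdeg _]/= !factS fact0 !natrM.
rewrite tE in h.
(* 7! = 3 * 56 * 30. *)
have -> : A (0, 0, 1)%N =
    3 * (56 * (30 * (A (0, 0, 1)%N / (7 * (6 * (5 * (4 * (3 * 2)))))))).
  by field.
by rewrite h mulrN1.
Qed.

(** * The recursion and its uniqueness *)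

Lemma ffactSr_natr (F : numFieldType) n k :
  (n ^_ k.+1)%:R = (n ^_ k)%:R * (n%:R - k%:R) :> F.
Proof.
have [kn|nk] := leqP k n; first by rewrite ffactnSr natrM natrB.
by rewrite !ffact_small ?mul0r// leqW.
Qed.

(** For j = 1 only the first two terms of [bcoefE] survive, and they differ by the factors s - 3 and
    4; this produces the root 7. *)
Lemma bcoef1 (F : numFieldType) s :
  (bcoef 1 s)%:~R = s%:R * (s%:R - 1) * (s%:R - 2) * (s%:R - 7) :> F.
Proof.
by rewrite bcoefE !ffactSr_natr ffactn0 /=; ring.
Qed.

Lemma bcoefC (F : numFieldType) j k : (bcoef j k)%:~R = (bcoef k j)%:~R :> F.
Proof. by rewrite !bcoefE; ring. Qed.

Lemma eq_sum_splits (G H : triple -> triple -> rat) l m n :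
  (forall l1 m1 n1, (l1 <= l)%N -> (m1 <= m)%N -> (n1 <= n)%N ->
    G (l1, m1, n1) (l - l1, m - m1, n - n1)%N =
    H (l1, m1, n1) (l - l1, m - m1, n - n1)%N) ->
  sum_splits G l m n = sum_splits H l m n.
Proof.
move=> GH; apply: eq_bigr => l1 _; apply: eq_bigr => m1 _.
by apply: eq_bigr => n1 _; apply: GH; rewrite -ltnS.
Qed.

Lemma sum_splitsD (G H : triple -> triple -> rat) l m n :
  sum_splits (fun i j => G i j + H i j) l m n =
  sum_splits G l m n + sum_splits H l m n.
Proof.
rewrite /sum_splits -big_split; apply: eq_bigr => l1 _ /=.
rewrite -big_split; apply: eq_bigr => m1 _ /=.
by rewrite -big_split.
Qed.

Lemma sum_splits_delta (G : triple -> triple -> rat) a b c l m n :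
  (a <= l)%N -> (b <= m)%N -> (c <= n)%N ->
  sum_splits (fun i j => if i == (a, b, c) then G i j else 0) l m n =
  G (a, b, c) (l - a, m - b, n - c)%N.
Proof.
move=> al bm cn; rewrite /sum_splits.
rewrite (bigD1 (Ordinal (al : (a < l.+1)%N)))//=.
rewrite [X in _ + X]big1 ?addr0; last first.
  move=> l1; rewrite -val_eqE /= => /negbTE la.
  by rewrite big1// => m1 _; rewrite big1// => n1 _; rewrite !xpair_eqE la.
rewrite (bigD1 (Ordinal (bm : (b < m.+1)%N)))//=.
rewrite [X in _ + X]big1 ?addr0; last first.
  move=> m1; rewrite -val_eqE /= => /negbTE mb.
  by rewrite big1// => n1 _; rewrite !xpair_eqE mb andbF.
rewrite (bigD1 (Ordinal (cn : (c < n.+1)%N)))//=.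
rewrite [X in _ + X]big1 ?addr0; last first.
  by move=> n1; rewrite -val_eqE /= => /negbTE nc; rewrite !xpair_eqE nc andbF.
by rewrite eqxx.
Qed.

(** The index must be nonzero for the two extreme terms to be distinct. *)
Lemma sum_splits_ends (G : triple -> triple -> rat) l m n :
  (l, m, n) != (0, 0, 0)%N ->
  sum_splits G l m n =
  sum_splits (fun i1 i2 => if (i1 == (0, 0, 0)%N) || (i1 == (l, m, n)) then 0
                           else G i1 i2) l m n
  + G (0, 0, 0)%N (l, m, n) + G (l, m, n) (0, 0, 0)%N.
Proof.
move=> i0.
have e0 := @sum_splits_delta G 0 0 0 l m n isT isT isT.
have ei := @sum_splits_delta G l m n l m n (leqnn _) (leqnn _) (leqnn _).
rewrite !subn0 in e0; rewrite !subnn in ei.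
rewrite -e0 -ei -!sum_splitsD; apply: eq_sum_splits => l1 m1 n1 _ _ _.
case: (eqVneq (l1, m1, n1) (0, 0, 0)%N) => [->|_] /=; last first.
  by case: eqP => _ /=; rewrite ?addr0 ?add0r.
by rewrite eq_sym (negbTE i0) addr0 add0r.
Qed.

Lemma taylor_recursion (A : triple -> rat) l m n :
  A (0, 0, 0)%N = 1 ->
  sum_splits (fun i1 i2 =>
      (bcoef (sdeg i1) (sdeg i2))%:~R * (taylor A i1 * taylor A i2)) l m n =
  2 * ((if m is m'.+1 then
          sum_splits (fun i1 i2 => taylor A i1 * taylor A i2) l m' n
        else 0)
     + (if l is l'.+1 then
          sum_splits (fun i1 i2 => taylor A i1 * taylor A i2) l' m n
        else 0)) ->
  tau_recursion A l m n.
Proof.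
move=> A0 id; rewrite /tau_recursion.
have -> : (fun i1 i2 => A i1 * A i2 / ((sdeg i1)`!%:R * (sdeg i2)`!%:R)) =
    (fun i1 i2 => taylor A i1 * taylor A i2).
  by apply/funext => i1; apply/funext => i2; rewrite /taylor mulf_div.
(* At the origin both sides vanish: s = 1 kills the left one, and the only term of the restricted
   sum is omitted. *)
have [[-> -> ->]|i0] := eqVneq (l, m, n) (0, 0, 0)%N.
  by rewrite /sum_splits !big_ord1 /= !subrr !(mulr0, mul0r, addr0).
have t0 : taylor A (0, 0, 0)%N = 1 by rewrite /taylor A0.
move: id; rewrite sum_splits_ends// t0 mul1r mulr1.
rewrite [sdeg (0, 0, 0)%N]/= (bcoefC _ _ 1) bcoef1.
set s := sdeg (l, m, n); set S := sum_splits _ l m n.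
rewrite -addrA => id.
rewrite (eq_sum_splits (H := fun i1 i2 =>
    if (i1 == (0, 0, 0)%N) || (i1 == (l, m, n)) then 0
    else (bcoef (sdeg i1) (sdeg i2))%:~R * (taylor A i1 * taylor A i2))) -/S.
  rewrite -[_ + _ + _]addrA.
  have -> : s%:R * (s%:R - 1) * (s%:R - 2) * (s%:R - 7) / s`!%:R * A (l, m, n)
      = s%:R * (s%:R - 1) * (s%:R - 2) * (s%:R - 7) * taylor A (l, m, n).
    by rewrite /taylor -/s; ring.
  move: id; move: (s%:R * _ * _ * _ * _) => q id.
  (* Both extreme terms equal [q] because [bcoef] is symmetric, so the full sum is S + 2q. *)
  transitivity (2^-1 * (S + (q + q)) - 2^-1 * S); first by field.
  by rewrite id mulKf// addrC mulNr.
by move=> l1 m1 n1 _ _ _; rewrite /taylor mulf_div.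
Qed.

(** Strong induction on [sdeg]. The leading factor vanishes only for s in {0, 1, 2, 7}: 0 and 2 are
    not values of [sdeg], while 1 and 7 are attained only at the two prescribed coefficients. *)
Lemma tau_recursion_unique (A B : triple -> rat) :
  A (0, 0, 0)%N = B (0, 0, 0)%N -> A (0, 0, 1)%N = B (0, 0, 1)%N ->
  (forall l m n, tau_recursion A l m n) ->
  (forall l m n, tau_recursion B l m n) ->
  forall l m n, A (l, m, n) = B (l, m, n).
Proof.
move=> AB0 AB1 rA rB l m n.
have [k] := ubnP (sdeg (l, m, n)); elim: k l m n => // k IH l m n sk.
have [[-> -> ->]//|i0] := eqVneq (l, m, n) (0, 0, 0)%N.
have [[-> -> ->]//|i1] := eqVneq (l, m, n) (0, 0, 1)%N.
have s0 : sdeg (l, m, n) != 0%N by rewrite /sdeg; lia.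
have s1 : sdeg (l, m, n) != 1%N.
  by move: i0; rewrite !xpair_eqE /sdeg; lia.
have s2 : sdeg (l, m, n) != 2%N by rewrite /sdeg; lia.
have s7 : sdeg (l, m, n) != 7%N.
  by move: i1; rewrite !xpair_eqE /sdeg; lia.
have := rA l m n; have := rB l m n; rewrite /tau_recursion.
set s := sdeg (l, m, n) in sk s0 s1 s2 s7 *.
have cn0 : s%:R * (s%:R - 1) * (s%:R - 2) * (s%:R - 7) / s`!%:R != 0 :> rat.
  rewrite mulf_neq0 ?invr_eq0 ?pnatr_eq0 -?lt0n ?fact_gt0// !mulf_neq0 //.
  - by rewrite pnatr_eq0.
  - by rewrite subr_eq0 (eqr_nat _ s 1).
  - by rewrite subr_eq0 (eqr_nat _ s 2).
  - by rewrite subr_eq0 (eqr_nat _ s 7).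
move=> eB eA; apply: (mulfI cn0); rewrite eA eB.
have IH' i : (sdeg i < s)%N -> A i = B i.
  by case: i => [[l1 m1] n1] si; apply: IH; exact: leq_trans si _.
congr (_ * _ + _ + _).
(* With both ends excluded, neither factor is the unknown coefficient, so both have smaller
   [sdeg]. *)
- apply: eq_sum_splits => l1 m1 n1 ll mm nn.
  case: eqVneq => //= j0; case: eqVneq => //= j1.
  rewrite !IH'// /s /sdeg; move: j0 j1; rewrite !xpair_eqE; lia.
- case: m {rA rB i0 i1 eA eB} @s sk IH' s0 s1 s2 s7 cn0 => //= m' sk IH' *.
  apply: eq_sum_splits => l1 m1 n1 ll mm nn.
  by rewrite !IH'// /sdeg; lia.
- case: l {rA rB i0 i1 eA eB} @s sk IH' s0 s1 s2 s7 cn0 => //= l' sk IH' *.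
  apply: eq_sum_splits => l1 m1 n1 ll mm nn.
  by rewrite !IH'// /sdeg; lia.
Qed.

Theorem theorem4p4 (R : realType)
  (u tau : Cplx R -> Cplx R -> Cplx R -> Cplx R -> Cplx R)
  (A : triple -> rat)
  (Hu : forall g2 lambda g3 : Cplx R,
     painleve1_solution g2 lambda g3 (u g2 lambda g3))
  (Htau : forall g2 lambda g3 : Cplx R,
     normalized_tau (u g2 lambda g3) (tau g2 lambda g3))
  (HA : forall g2 lambda g3 : Cplx R,
     tau_expansion A g2 lambda g3 (tau g2 lambda g3)) :
  [/\ A (0, 0, 0)%N = 1,
      A (0, 0, 1)%N = - 3,
      forall l m n : nat, tau_recursion A l m n &
      forall B : triple -> rat,
        B (0, 0, 0)%N = 1 -> B (0, 0, 1)%N = - 3 ->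
        (forall l m n : nat, tau_recursion B l m n) ->
        forall l m n : nat, B (l, m, n) = A (l, m, n)].
Proof.
have A0 := tau_A000 Htau HA; have A1 := tau_A001 Hu Htau HA.
have rA l m n : tau_recursion A l m n.
  by apply: taylor_recursion => //; exact: taylor_identity Hu Htau HA _ _ _.
split=> // B B0 B1 rB; apply: tau_recursion_unique => //.
- by rewrite B0 A0.
- by rewrite B1 A1.
Qed.
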